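(* Let $f:X\to Y$ be a function between $S_2$-spaces. Then $f$ is sequentially proper if and only if $f$ is B-proper.
   Context: A subset $U$ of a topological space is sequentially open if every sequence converging to a point of $U$ is eventually in $U$; a subset is sequentially closed if its complement is sequentially open; a space is sequential if every sequentially open subset is open. A space is sequentially Hausdorff if every convergent sequence has a unique limit. An $S_2$-space is a space that is sequential and sequentially Hausdorff. A proper sequence in $X$ is a sequence $s:\mathbb{N}\to X$ such that $s^{-1}(K)$ is finite for every closed compact $K\subset X$. A function $f:X\to Y$ is sequentially continuous if $s\to x$ in $X$ implies $f\circ s\to f(x)$ in $Y$. It is sequentially proper if it is sequentially continuous and $f\circ s$ is a proper sequence in $Y$ for every proper sequence $s$ in $X$. It is B-proper (sequentially proper in the sense of Brown) if it is sequentially continuous and, for every topological space $Z$, the function $f\times 1_Z:X\times Z\to Y\times Z$ is sequentially closed, i.e. sends sequentially closed subsets to sequentially closed subsets. *)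

(* Defs.v *)
From mathcomp Require Import all_boot all_order.
From mathcomp Require Import all_classical topology.

Set Implicit Arguments.
Unset Strict Implicit.
Unset Printing Implicit Defensive.

Local Open Scope classical_set_scope.

Definition seq_open (X : topologicalType) (U : set X) : Prop :=
  forall (s : nat -> X) (x : X),
    s @ \oo --> x -> U x -> \forall n \near \oo, U (s n).

Definition seq_closed (X : topologicalType) (A : set X) : Prop :=
  seq_open (~` A).

Definition sequential_space (X : topologicalType) : Prop :=
  forall U : set X, seq_open U -> open U.

Definition seq_hausdorff (X : topologicalType) : Prop :=
  forall (s : nat -> X) (x y : X),
    s @ \oo --> x -> s @ \oo --> y -> x = y.

Definition S2_space (X : topologicalType) : Prop :=
  sequential_space X /\ seq_hausdorff X.

Definition proper_sequence (X : topologicalType) (s : nat -> X) : Prop :=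
  forall K : set X, closed K -> compact K -> finite_set (s @^-1` K).

Definition seq_continuous (X Y : topologicalType) (f : X -> Y) : Prop :=
  forall (s : nat -> X) (x : X),
    s @ \oo --> x -> (f \o s) @ \oo --> f x.

Definition seq_proper (X Y : topologicalType) (f : X -> Y) : Prop :=
  seq_continuous f /\
  forall s : nat -> X, proper_sequence s -> proper_sequence (f \o s).

Definition seq_closed_map (X Y : topologicalType) (f : X -> Y) : Prop :=
  forall A : set X, seq_closed A -> seq_closed (f @` A).

Definition B_proper (X Y : topologicalType) (f : X -> Y) : Prop :=
  seq_continuous f /\
  forall Z : topologicalType,
    seq_closed_map (fun p : (X * Z)%type => (f p.1, p.2)).

(* Main.v *)
Require Import Defs.
From mathcomp Require Import all_boot all_order.
From mathcomp Require Import all_classical topology.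

(** In an S2-space, properness of a sequence can be said without mentioning
    compact sets: a sequence is proper exactly when none of its subsequences
    converges ([proper_sequenceP]).  In one direction, a convergent sequence
    together with its limit is a compact set, and it is closed; in the other, a
    compact subset of an S2-space is sequentially compact ([compact_sublimit]).
    Both directions rest on [seq_closed_range]: where sequential limits are
    unique, the values of a sequence, together with a sequentially closed set
    containing the limits of its subsequences, form a sequentially closed set.

    Sequentially proper implies B-proper.  Let [(f (x_n), z_n)] converge to
    [(y, z)] with all [(x_n, z_n)] in a sequentially closed set [A].  The
    sequence [f (x_n)] converges, hence is not proper, so [x_n] is not proper
    either: some subsequence of it converges to a point [x].  Then [f x = y] by
    uniqueness of limits, and [(x, z)] lies in [A].

    B-proper implies sequentially proper.  Let [s] be proper and suppose that
    [f (s (phi n))] converges to [y].  In the product of [X] with the convergent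
    sequence [{0, 1, ..., oo}], the points [(s (phi n), n)] form a sequentially
    closed set, since no subsequence of [s] converges.  Its image contains the
    points [(f (s (phi n)), n)] but not their limit [(y, oo)], so [f] is not
    B-proper. *)

Local Open Scope classical_set_scope.

(** Asking only for [n <= phi n], instead of a strictly increasing [phi], keeps
    the limits of subsequences the same: such a [phi] has a strictly increasing
    restriction to a subset of its indices.  The weaker condition is the easier
    one to construct, by one choice for each index, and it is stable under
    composition. *)
Definition sublimit {X : topologicalType} (s : nat -> X) (x : X) : Prop :=
  exists phi : nat -> nat,
    (forall n, n <= phi n) /\ (s \o phi) @ \oo --> x.

Lemma cvg_cofinal (phi : nat -> nat) :
  (forall n, n <= phi n) -> phi @ \oo --> \oo.
Proof.
move=> hphi P [N _ NP]; exists N => // n /= Nn; apply: NP => /=.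
exact: leq_trans (hphi n).
Qed.

Lemma frequently_cofinal (P : set nat) :
  ~ (\forall n \near \oo, ~ P n) ->
  exists phi : nat -> nat, (forall n, n <= phi n) /\ forall n, P (phi n).
Proof.
move=> freqP.
have /choice[phi hphi] : forall n, exists m, n <= m /\ P m.
  move=> n; apply: contrapT => noP; apply: freqP; exists n => // m /= nm Pm.
  by apply: noP; exists m.
by exists phi; split=> n; have [] := hphi n.
Qed.

(** Indices [m n] that leave every value for good tend to infinity, so a
    sequence re-indexed by them, though neither monotone nor injective, still
    contains a subsequence of [s]. *)
Lemma cvg_eventually_sublimit {X : topologicalType} (s : nat -> X) (x : X)
    (m : nat -> nat) :
  (s \o m) @ \oo --> x -> (forall v, \forall n \near \oo, m n <> v) ->
  sublimit s x.
Proof.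
move=> smx esc.
have big N : \forall n \near \oo, N <= m n.
  elim: N => [|N IHN]; first exact: nearW.
  have escN := esc N; near=> n.
  have neN : m n <> N by near: n.
  have leN : N <= m n by near: n.
  by rewrite ltn_neqAle leN andbT; apply/eqP => /esym.
have /choice[psi hpsi] : forall N, exists n, N <= n /\ N <= m n.
  move=> N; have [M _ HM] := big N; exists (maxn N M); rewrite leq_maxl.
  by split=> //; apply: HM; rewrite /= leq_maxr.
exists (m \o psi); split; first by move=> n; have [] := hpsi n.
apply: (@cvg_comp _ _ _ psi (s \o m)) smx; apply: cvg_cofinal => n.
by have [] := hpsi n.
Unshelve. all: by end_near. Qed.

Lemma seq_closedP {X : topologicalType} (A : set X) :
  seq_closed A <->
  forall (t : nat -> X) (x : X), (forall n, A (t n)) -> t @ \oo --> x -> A x.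
Proof.
split=> [Acl t x At tx|Acl t x tx nAx].
  apply: contrapT => nAx.
  by have [N _ /(_ N (leqnn N))] := Acl _ _ tx nAx; apply.
apply: contrapT => freqA.
have [|phi [hphi Atphi]] := @frequently_cofinal [set n | A (t n)].
  by move=> nearA; apply: freqA.
apply: nAx; apply: Acl Atphi _; apply: cvg_comp tx; exact: cvg_cofinal.
Qed.

Lemma seq_closed0 {X : topologicalType} : seq_closed (@set0 X).
Proof. by move=> s x _ _; apply: nearW => n []. Qed.

Lemma seq_closed1 {X : topologicalType} (x : X) :
  seq_hausdorff X -> seq_closed [set x].
Proof.
move=> Xh; apply/seq_closedP => t y tx ty; apply: (Xh t y x ty).
by rewrite (_ : t = fun=> x); [exact: cvg_cst|apply/funext => n; exact: tx].
Qed.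

Lemma sequential_seq_closed {X : topologicalType} (A : set X) :
  sequential_space X -> seq_closed A -> closed A.
Proof. by move=> Xseq /Xseq; rewrite openC. Qed.

(** A sequence of values of [s] can be written [s \o m].  If [m] takes some
    value [v] infinitely often, uniqueness of limits forces the limit to be
    [s v].  Otherwise [m] leaves every value and the limit is that of a
    subsequence of [s].  The set [C] is empty when [s] has no convergent
    subsequence, and a singleton when [s] converges. *)
Lemma seq_closed_range {X : topologicalType} (s : nat -> X) (I : set nat)
    (C : set X) :
  seq_hausdorff X -> seq_closed C -> sublimit s `<=` C ->
  seq_closed (s @` I `|` C).
Proof.
move=> Xh Ccl limC; apply/seq_closedP => t x At tx.
apply: contrapT => /not_orP[nIx nCx].
(* Off a finite segment, [t] takes its values among those of [s] only. *)
have [N _ tC] := Ccl _ _ tx nCx.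
have /choice[m hm] : forall n, exists m, I m /\ s m = t (n + N)%N.
  move=> n; have [[m Im sm]|/tC] := At (n + N)%N; first by exists m.
  by case; rewrite /= leq_addl.
have smE : s \o m = t \o addn^~ N.
  by apply/funext => n; have [] := hm n.
have smx : (s \o m) @ \oo --> x.
  by rewrite smE; apply: cvg_comp tx; exact: cvg_addnr.
apply/nCx/limC/(cvg_eventually_sublimit _ _ _ smx) => v.
apply: contrapT => freqv.
have [//|psi [hpsi mpsi]] := @frequently_cofinal [set n | m n = v].
apply: nIx; exists v; first by rewrite -(mpsi 0); have [] := hm (psi 0).
apply: (Xh (s \o m \o psi)); last first.
  by apply: cvg_comp smx; exact: cvg_cofinal.
rewrite [_ \o _](_ : _ = fun=> s v); first exact: cvg_cst.
by apply/funext => n /=; rewrite mpsi.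
Qed.

(** If no subsequence of [s] converged, every tail of [s] would be closed by
    [seq_closed_range].  A cluster point [p], which exists by compactness, would
    then belong to every tail, so that [s] would take the value [p] infinitely
    often: a constant, hence convergent, subsequence. *)
Lemma compact_sublimit {X : topologicalType} (K : set X) (s : nat -> X) :
  S2_space X -> compact K -> (forall n, K (s n)) -> exists x, sublimit s x.
Proof.
move=> [Xs Xh] Kc Ks; apply: contrapT => nolim.
have tail_closed : forall n, closed (s @` [set m | n <= m]).
  move=> n; apply: sequential_seq_closed => //; rewrite -[_ @` _]setU0.
  apply: seq_closed_range Xh (@seq_closed0 X) _ => x limx.
  by apply: nolim; exists x.
have [|p [Kp clp]] := Kc (s @ \oo) (fmap_proper_filter s eventually_filter).
  by exists 0 => // k _; exact: Ks.
have freqp : ~ \forall n \near \oo, ~ s n = p.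
  move=> [N _ HN].
  have /tail_closed[n Nn snp] : closure (s @` [set m | N <= m]) p.
    by move=> B pB; apply: clp => //; exists N => // n Nn; exists n.
  exact: HN snp.
have [phi [hphi sphi]] := frequently_cofinal _ freqp.
apply: nolim; exists p, phi; split=> //.
rewrite [_ \o _](_ : _ = fun=> p); first exact: cvg_cst.
by apply/funext => n /=; rewrite sphi.
Qed.

(** A neighbourhood of the limit absorbs all but finitely many terms. *)
Lemma compact_cvg_range {X : topologicalType} (s : nat -> X) (x : X) :
  s @ \oo --> x -> compact (range s `|` [set x]).
Proof.
move=> sx; apply/compact_near_coveringP => I F P FF cov.
have [[U G] [/= Ux FG] UGP] := cov x (or_intror erefl).
have [N _ sU] := sx _ Ux.
have /compact_near_coveringP initc : compact (s @` `I_N).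
  by apply: finite_compact; apply: finite_image; exact: finite_II.
have initP : \forall i \near F, s @` `I_N `<=` P i.
  by apply: initc => // _ [n _ <-]; apply: cov; left; exists n.
near=> i; have Gi : G i by near: i.
move=> _ [[n _ <-]|->]; last first.
  by apply: (UGP (x, i)); split=> //; exact: nbhs_singleton.
have [nN|Nn] := ltnP n N; last by apply: (UGP (s n, i)); split=> //; exact: sU.
suff : s @` `I_N `<=` P i by apply; exists n.
by near: i.
Unshelve. all: by end_near. Qed.

(** Each point [n] has the neighbourhood [[set n]], on which [fun k => k < N]
    holds for all large [N]; compactness makes [N] uniform.  Applied to finite
    sets, this also bounds them. *)
Lemma compact_nat_bounded (A : set nat) :
  compact A -> exists N, forall n, A n -> n < N.
Proof.
move=> /compact_near_coveringP Ac.
have [//|N _ HN] := Ac nat \oo (fun N n => n < N) _ _.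
  move=> n _; exists ([set n], [set N | n < N]); last by case=> a b [/= -> ].
  by split; [exact/principal_filterP|exact: nbhs_infty_gt].
by exists N => n An; apply: (HN N) An => /=.
Qed.

(** Compact sets disappear from the notion of proper sequence.  Along a
    convergent subsequence, the values and the limit form a closed compact set
    that [s] meets infinitely often; conversely, meeting a compact set
    infinitely often produces a convergent subsequence. *)
Lemma proper_sequenceP {X : topologicalType} (s : nat -> X) :
  S2_space X -> (proper_sequence s <-> forall x, ~ sublimit s x).
Proof.
move=> XS; have [Xs Xh] := XS; split=> [sp x [phi [hphi sphix]]|nolim K Kcl Kc].
  pose K := range (s \o phi) `|` [set x].
  have Kcl : closed K.
    apply: sequential_seq_closed => //.
    apply: (seq_closed_range _ _ _ Xh (seq_closed1 x Xh)).
    move=> y [psi [hpsi sy]]; apply: (Xh _ _ _ sy).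
    by apply: cvg_comp sphix; exact: cvg_cofinal.
  have /finite_compact/compact_nat_bounded[N HN] :=
    sp K Kcl (compact_cvg_range _ _ sphix).
  have : phi N < N by apply: HN; left; exists N.
  by rewrite ltnNge hphi.
apply: contrapT => infK.
have [|phi [hphi Kphi]] := @frequently_cofinal (s @^-1` K).
  move=> [N _ HN]; apply: infK; apply: sub_finite_set (finite_II N) => n Kn.
  by rewrite /= ltnNge; apply/negP => Nn; exact: HN Kn.
have [x [psi [hpsi sx]]] := compact_sublimit K (s \o phi) XS Kc Kphi.
apply: (nolim x); exists (phi \o psi); split=> // n.
exact: leq_trans (hphi _).
Qed.

(* The generic convergent sequence: the discrete naturals with a point [None] at
   infinity. *)
Local Notation Noo := (one_point_compactification nat).

Lemma cvg_Some_infty : (Some : nat -> Noo) @ \oo --> (None : Noo).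
Proof.
move=> U [W [Wc _] WU]; have [N HN] := compact_nat_bounded W Wc.
exists N => // n /= Nn; apply: WU; left; exists n => // Wn.
by have := HN _ Wn; rewrite ltnNge Nn.
Qed.

Lemma nbhs_Some (n : nat) : nbhs (Some n : Noo) [set Some n].
Proof. by exact/principal_filterP. Qed.

(** Separates [None] from each natural number; with [nbhs_Some], this is all the
    separation that uniqueness of limits requires. *)
Lemma nbhs_None (n : nat) : nbhs (None : Noo) (~` [set Some n]).
Proof.
exists [set n]; first by split; [exact: compact_set1|exact: discrete_closed].
by move=> _ [[m nm <-]|->] //= [mn]; exact: nm.
Qed.

Lemma one_point_nat_seq_hausdorff : seq_hausdorff Noo.
Proof.
have isolated (t : nat -> Noo) n (p : Noo) :
    t @ \oo --> (Some n : Noo) -> t @ \oo --> p -> Some n = p.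
  move=> /(_ _ (nbhs_Some n)) tn.
  case: p => [m /(_ _ (nbhs_Some m))|/(_ _ (nbhs_None n))] tp;
    by have [k /= [tk]] := filter_ex (filterI tn tp); rewrite tk.
by move=> t [n|] [m|] // tp tq; [exact: isolated tp tq|exact: isolated tp tq|
  exact/esym/(isolated _ _ _ tq tp)].
Qed.

Lemma cvg_prodP {X Z : topologicalType} (t : nat -> X * Z) (p : X * Z) :
  t @ \oo --> p <-> (fst \o t) @ \oo --> p.1 /\ (snd \o t) @ \oo --> p.2.
Proof.
split=> [tp|[t1 t2]]; last first.
  rewrite [t](_ : _ = fun n => ((fst \o t) n, (snd \o t) n)).
    by case: p t1 t2 => a b; exact: cvg_pair.
  by apply/funext => n /=; case: (t n).
by case: p tp => a b tp; split; apply: cvg_comp tp _;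
  [exact: cvg_fst|exact: cvg_snd].
Qed.

Lemma seq_hausdorff_prod {X Z : topologicalType} :
  seq_hausdorff X -> seq_hausdorff Z -> seq_hausdorff (X * Z)%type.
Proof.
move=> Xh Zh t [x z] [x' z'] /cvg_prodP[/= tx tz] /cvg_prodP[/= tx' tz'].
by rewrite (Xh _ _ _ tx tx') (Zh _ _ _ tz tz').
Qed.

Theorem theorem3p3 (X Y : topologicalType) (hX : S2_space X) (hY : S2_space Y)
  (f : X -> Y) : seq_proper f <-> B_proper f.
Proof.
split=> -[fc fp]; split=> //.
  move=> Z A Acl; apply/seq_closedP => t [y z] At /cvg_prodP[/= ty tz].
  have /choice[u hu] : forall n, exists p, A p /\ (f p.1, p.2) = t n.
    by move=> n; have [p Ap pt] := At n; exists p.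
  have fuE : f \o (fst \o u) = fst \o t.
    by apply/funext => n /=; have [_ <-] := hu n.
  have u2E : snd \o u = snd \o t.
    by apply/funext => n /=; have [_ <-] := hu n.
  (* [f] maps [fst \o u] to a convergent sequence, hence to a non-proper one. *)
  have [x [phi [hphi ux]]] : exists x, sublimit (fst \o u) x.
    apply: contrapT => nolim.
    have /fp /(proper_sequenceP _ hY) : proper_sequence (fst \o u).
      by apply/(proper_sequenceP _ hX) => x limx; apply: nolim; exists x.
    by rewrite fuE => /(_ y); apply; exists id.
  have subc := cvg_cofinal _ hphi.
  exists (x, z) => /=.
    move/seq_closedP: Acl => /(_ (u \o phi)); apply.
      by move=> n; have [] := hu (phi n).
    apply/cvg_prodP; split=> //=.
    by rewrite -u2E in tz; exact: cvg_comp subc tz.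
  congr (_, _); apply: (hY.2 _ _ _ (fc _ _ ux)).
  by rewrite [f \o _]compA fuE; exact: cvg_comp subc ty.
move=> s /(proper_sequenceP _ hX) nolim.
apply/(proper_sequenceP _ hY) => y [phi [hphi fsy]].
pose graph n : X * Noo := (s (phi n), Some n).
have graph_closed : seq_closed (range graph).
  rewrite -[range _]setU0.
  apply: seq_closed_range; [|exact: seq_closed0|].
    by apply: seq_hausdorff_prod one_point_nat_seq_hausdorff; exact: hX.2.
  move=> p [psi [hpsi /cvg_prodP[/= sx _]]]; apply: (nolim p.1).
  by exists (phi \o psi); split=> // n; exact: leq_trans (hphi _).
(* The limit [(y, None)] of the image of [graph] would lie in that image, whose
   points all have a finite second coordinate. *)
move/fp/seq_closedP: graph_closed.
move=> /(_ (fun n => (f (s (phi n)), Some n)) (y, None)).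
case=> [n||_ [n _ <-] //]; first by exists (graph n) => //; exists n.
by apply/cvg_prodP; split=> //=; exact: cvg_Some_infty.
Qed.
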